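(* Let $W$ be an affine Weyl group, $\mathring W$ the associated finite Weyl group, and $\pi_0,\pi_1,\dots,\pi_n$ the generators of the $0$-Hecke algebra of $W$. Then the level $0$ action of $\pi_0,\pi_1,\dots,\pi_n$ on $\mathring W$ is transitive: for all $u,v\in\mathring W$ there exist $i_1,\dots,i_r\in\{0,\dots,n\}$ (with $r\ge0$) such that $u.\pi_{i_1}\cdots\pi_{i_r}=v$.
   Context: Affine Weyl group. Let $M=(a_{i,j})_{i,j\in I}$, $I=\{0,\dots,n\}$, $n\ge1$, be an indecomposable generalized Cartan matrix of affine type (twisted or untwisted) and $W=\langle s_i\mid i\in I\rangle$ its affine Weyl group. Let $\mathfrak h^*=\bigoplus_{i\in I}\mathbb{R}\alpha_i$ and let $\mathfrak h=\bigoplus_{i\in I}\mathbb{R}\Lambda_i^\vee$ be its dual, $\langle\Lambda^\vee_i,\alpha_j\rangle=\delta_{ij}$; put $\alpha_i^\vee=\sum_j a_{i,j}\Lambda_j^\vee$, so $\langle\alpha_i^\vee,\alpha_j\rangle=a_{i,j}$. $W$ acts on $\mathfrak h$ by $s_i(x)=x-\langle x,\alpha_i\rangle\alpha_i^\vee$. Let $\delta=\sum_i a_i\alpha_i$, where the $a_i$ are the positive coprime integers with $\sum_j a_{i,j}a_j=0$ for all $i$. $W$ stabilizes $\mathfrak h^0=\{x\in\mathfrak h\mid\langle x,\delta\rangle=0\}$. The group $\mathring W$ is the (finite) image of $W$ in $GL(\mathfrak h^0)$, and $\mathrm{cl}:W\to\mathring W$ is the quotient map; nodes are labelled so that $\mathrm{cl}$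 restricts to an isomorphism from $\langle s_1,\dots,s_n\rangle$ onto $\mathring W$, through which these groups are identified. Level $0$ action. Let $\mathring\rho^\vee\in\mathfrak h^0$ be the half sum of the positive coroots of $\mathring W$ (positive with respect to the simple coroots $\alpha_1^\vee,\dots,\alpha_n^\vee$). For $w\in\mathring W$ and $i\in I$, $w.\pi_i=w\,\mathrm{cl}(s_i)$ if $\langle w^{-1}(\mathring\rho^\vee),\alpha_i\rangle>0$, and $w.\pi_i=w$ otherwise. (For $i\ge1$ the condition means $\ell(ws_i)>\ell(w)$.) *)

(* Defs.v *)
From HB Require Import structures.
From mathcomp Require Import all_boot all_order all_algebra.
From mathcomp Require Import mathcomp_extra boolp classical_sets functions.
From mathcomp Require Import cardinality fsbigop reals.

Set Implicit Arguments.
Unset Strict Implicit.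
Unset Printing Implicit Defensive.

Import Order.TTheory GRing.Theory Num.Theory.
Local Open Scope classical_set_scope.
Local Open Scope ring_scope.

Definition generalized_cartan (n : nat) (A : 'M[int]_n.+1) : Prop :=
  [/\ forall i, A i i = 2,
      forall i j, i != j -> A i j <= 0
    & forall i j, A i j = 0 -> A j i = 0].

(* Zeros of a generalized Cartan matrix are symmetric, so one off-diagonal
   block of a partition vanishes iff both do. *)
Definition indecomposable (n : nat) (A : 'M[int]_n.+1) : Prop :=
  forall J : {set 'I_n.+1}, J != finset.set0 -> J != [set: 'I_n.+1]%SET ->
  exists i j, [/\ i \in J, j \notin J & A i j != 0].

Section LevelZero.
Context (R : realType) (n : nat) (A : 'M[int]_n.+1).

Definition realmx : 'M[R]_n.+1 := map_mx intr A.

(* The class (Aff) of Kac's trichotomy for indecomposable generalized Cartan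
   matrices (Infinite dimensional Lie algebras, Theorem 4.3). *)
Definition affine_type : Prop :=
  [/\ \rank realmx = n,
      exists u : 'cV[R]_n.+1, (forall i, 0 < u i 0) /\ realmx *m u = 0
    & forall v : 'cV[R]_n.+1,
        (forall i, 0 <= (realmx *m v) i 0) -> realmx *m v = 0].

(* h has basis (Lambda_i^vee) and h^* has the dual basis (alpha_i); elements of
   h are rows of coordinates, elements of h^* are columns. *)
Local Notation h := 'rV[R]_n.+1.
Local Notation hdual := 'cV[R]_n.+1.

Definition pairing (x : h) (b : hdual) : R := (x *m b) 0 0.

Definition root (i : 'I_n.+1) : hdual := delta_mx i 0.

Definition coroot (i : 'I_n.+1) : h := row i realmx.

Definition refl_fun (i : 'I_n.+1) (x : h) : h :=
  x - pairing x (root i) *: coroot i.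

Fact refl_fun_linear i : linear (refl_fun i).
Proof.
move=> c x y; rewrite /refl_fun /pairing mulmxDl -scalemxAl !mxE.
by rewrite scalerDl -scalerA opprD addrACA scalerBr.
Qed.

HB.instance Definition _ (i : 'I_n.+1) :=
  GRing.isLinear.Build R h h *:%R (refl_fun i) (refl_fun_linear i).

Definition refl (i : 'I_n.+1) : 'End(h) := linfun (refl_fun i).

(* The subgroup generated by the s_i, i \in P; words suffice because the s_i
   are involutions. *)
Definition reflection_group (P : pred 'I_n.+1) : set 'End(h) :=
  [set w | exists2 l : seq 'I_n.+1,
      all P l & w = \big[@comp_lfun R h h h / \1%VF]_(i <- l) refl i].

Definition affine_weyl : set 'End(h) := reflection_group predT.

Definition parabolic_weyl : set 'End(h) := reflection_group (predC1 ord0).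

Context (a : 'I_n.+1 -> nat).

Definition delta_coefficients : Prop :=
  [/\ forall i, (0 < a i)%N,
      \big[gcdn/0%N]_i a i = 1%N
    & forall i, \sum_j A i j * (a j)%:Z = 0].

Definition delta : hdual := \sum_i (a i)%:R *: root i.

Definition h0 : {vspace h} := lker (linfun (mulmxr delta : h -> 'M[R]_1)).

Local Notation H0 := (subvs_of h0).

(* w restricted to h0; it is composed with the projection onto h0 only for
   typing, since W stabilizes h0 (see val_cl below). *)
Definition cl (w : 'End(h)) : 'End(H0) :=
  (linfun (vsproj h0) \o w \o linfun (@vsval R h h0))%VF.

Definition finite_weyl : set 'End(H0) := cl @` affine_weyl.

(* cl is multiplicative on W (see cl_comp below), hence bijectivity is all that
   is required of an isomorphism. *)
Definition good_labelling : Prop := set_bij parabolic_weyl finite_weyl cl.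

Definition coroot0 (i : 'I_n.+1) : H0 := vsproj h0 (coroot i).

Definition finite_coroots : set H0 :=
  [set b | exists w i, [/\ finite_weyl w, i != ord0 & b = w (coroot0 i)]].

Definition positive_coroots : set H0 :=
  [set b | finite_coroots b /\
     exists c : 'I_n.+1 -> R, (forall i, 0 <= c i) /\
       b = \sum_(i | i != ord0) c i *: coroot0 i].

(* The sum is finitely supported because the finite Weyl group is finite. *)
Definition rho_check : H0 := 2^-1 *: \sum_(b \in positive_coroots) b.

(* (w^-1)%VF is the two-sided inverse, as elements of finite_weyl are
   bijective. *)
Definition pi_act (w : 'End(H0)) (i : 'I_n.+1) : 'End(H0) :=
  if 0 < pairing (vsval ((w^-1)%VF rho_check)) (root i)
  then (w \o cl (refl i))%VF else w.

Lemma reflE i x : refl i x = x - pairing x (root i) *: coroot i.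
Proof. by rewrite lfunE. Qed.

Lemma mem_h0 x : (x \in h0) = (pairing x delta == 0).
Proof.
rewrite memv_ker lfunE /= /pairing; apply/eqP/eqP => [-> | e]; first by rewrite mxE.
by apply/matrixP => i j; rewrite !ord1 e mxE.
Qed.

Hypothesis a_delta : delta_coefficients.

Lemma coroot_h0 i : coroot i \in h0.
Proof.
case: a_delta => _ _ da; rewrite mem_h0 /pairing /delta mulmx_sumr summxE.
have /(congr1 (fun z : int => z%:~R : R)) := da i.
rewrite rmorph_sum /= => E; apply/eqP; rewrite -[RHS]E.
apply: eq_bigr => j _; rewrite -scalemxAr /root -colE !mxE rmorphM /=.
by rewrite mulrC.
Qed.

Lemma affine_weyl_h0 w x : affine_weyl w -> x \in h0 -> w x \in h0.
Proof.
case=> l _ ->; elim: l x => [|i l IH] x hx; first by rewrite big_nil lfunE.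
rewrite big_cons comp_lfunE reflE rpredB ?IH //.
by rewrite rpredZ // coroot_h0.
Qed.

Lemma val_cl w (x : H0) : affine_weyl w -> vsval (cl w x) = w (vsval x).
Proof.
move=> Ww; rewrite !comp_lfunE lfunE /= lfunE /= vsprojK //.
by apply: affine_weyl_h0 => //; exact: subvsP.
Qed.

Lemma cl_comp w w' : affine_weyl w -> affine_weyl w' ->
  cl (w \o w')%VF = (cl w \o cl w')%VF.
Proof.
move=> Ww Ww'; apply/lfunP => x; rewrite !comp_lfunE !lfunE /=.
by rewrite vsprojK //; apply: affine_weyl_h0 => //; exact: subvsP.
Qed.

End LevelZero.

(* Main.v *)
Require Import Defs.
From mathcomp Require Import all_boot all_order all_algebra.
From mathcomp Require Import ring lra zify.
From mathcomp Require Import boolp classical_sets cardinality fsbigop reals.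

(** Send [w] to the vector [x = w^-1 rho] of [h0]: the operator [pi_i] moves [x]
to [s_i x] exactly when [<x, alpha_i> > 0].  Give the edge between [x] and
[s_i x] the weight [a_i |<x, alpha_i>|].  The net outflow at [x] is
[sum_i a_i <x, alpha_i> = <x, delta> = 0], so this is a circulation with positive
weights on a finite graph, and a finite set which no edge leaves is entered by
none either: it is stable under all the [s_i], hence under the finite Weyl group.

It remains to know that the orbit of [rho] is finite and its stabilizer trivial.
The Cartan matrix is symmetrizable: after conjugation by [a], the arithmetic-geometric
mean inequality bounds the number of edges of the Dynkin diagram by [n + 1], and
either the bound is reached and the matrix is symmetric, or the diagram is a tree.
The resulting form is positive definite on the span of the finite simple coroots,
which gives finiteness; a minimal norm argument in a lattice shows that
coroots are positive or negative; the exchange condition then gives the triviality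
of the stabilizer. *)

Set Implicit Arguments.
Unset Strict Implicit.
Unset Printing Implicit Defensive.

Import Order.TTheory GRing.Theory Num.Theory.
Local Open Scope ring_scope.

(** * Symmetrizability *)

Section Symmetrizability.
Context (R : realFieldType) (n : nat) (A : 'M[int]_n.+1) (a : 'I_n.+1 -> nat).
Hypothesis A_gcm : generalized_cartan A.
Hypothesis A_indec : indecomposable A.
Hypothesis a_delta : delta_coefficients A a.

Lemma a_gt0 i : 0 < (a i)%:R :> R.
Proof. by case: a_delta => a0 _ _; rewrite ltr0n. Qed.

Lemma sum_a_row i : \sum_j (A i j)%:~R * (a j)%:R = 0 :> R.
Proof.
case: a_delta => _ _ /(_ i) /(congr1 (fun z : int => z%:~R : R)).
rewrite rmorph_sum /= => e; rewrite -[RHS]e; apply: eq_bigr => j _.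
by rewrite rmorphM.
Qed.

Lemma gcm_diag i : A i i = 2.
Proof. by case: A_gcm. Qed.

Lemma gcm_offdiag i j : i != j -> A i j <= 0.
Proof. by case: A_gcm => _ + _; apply. Qed.

Lemma gcm_eq0C i j : (A i j == 0) = (A j i == 0).
Proof. by case: A_gcm => _ _ z; apply/eqP/eqP; exact: z. Qed.

Definition adj (i j : 'I_n.+1) : nat := (i != j) && (A i j != 0).

Lemma adjC i j : adj i j = adj j i.
Proof. by rewrite /adj eq_sym gcm_eq0C. Qed.

Lemma adjii i : adj i i = 0%N.
Proof. by rewrite /adj eqxx. Qed.

(** Ordered pairs are counted, so each edge contributes 2 and a tree on [k.+1] nodes has [k.*2]
    arcs. *)
Definition arcs (J : {set 'I_n.+1}) : nat := (\sum_(i in J) \sum_(j in J) adj i j)%N.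

Lemma arcsU1 (J : {set 'I_n.+1}) j : j \notin J ->
  arcs (j |: J) = (arcs J + (\sum_(i in J) adj j i).*2)%N.
Proof.
move=> jJ; rewrite /arcs big_setU1 //= big_setU1 //= adjii add0n.
have -> : (\sum_(i in J) \sum_(k in j |: J) adj i k =
    \sum_(i in J) adj j i + \sum_(i in J) \sum_(k in J) adj i k)%N.
  by rewrite -big_split; apply: eq_bigr => i _; rewrite big_setU1 //= adjC.
by rewrite addnA addnn; rewrite addnC.
Qed.

(** The excess over 2 is [(x - 1) t + (y - 1) / t + (t - 1)^2 / t], a sum of nonnegative terms;
    equality kills the first two. *)
Lemma weighted_ge2 (t x y : R) : 0 < t -> 1 <= x -> 1 <= y ->
  2 <= x * t + y / t /\ (x * t + y / t <= 2 -> x = 1 /\ y = 1).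
Proof.
move=> t0 x1 y1.
have e : x * t + y / t = 2 + ((x - 1) * t + (y - 1) / t + (t - 1) ^+ 2 / t).
  by field; rewrite gt_eqF.
have p1 : 0 <= (x - 1) * t by apply: mulr_ge0; [rewrite subr_ge0 | exact: ltW].
have p2 : 0 <= (y - 1) / t by apply: divr_ge0; [rewrite subr_ge0 | exact: ltW].
have p3 : 0 <= (t - 1) ^+ 2 / t by apply: divr_ge0; [exact: sqr_ge0 | exact: ltW].
split; first by rewrite e; lra.
rewrite e => le2.
have /eqP : (x - 1) * t = 0 by lra.
have /eqP : (y - 1) / t = 0 by lra.
rewrite !mulf_eq0 invr_eq0 (gt_eqF t0) !orbF !subr_eq0.
by move=> /eqP -> /eqP ->.
Qed.

(** Negated entries of [A] conjugated by the diagonal matrix of [a]: since [A] annihilates [a], each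
    row has off-diagonal sum 2. *)
Definition arc_weight i j : R := - (A i j)%:~R * (a j)%:R / (a i)%:R.

Lemma sum_arc_weight i : \sum_(j | j != i) arc_weight i j = 2.
Proof.
have := sum_a_row i; rewrite (bigD1 i) //= gcm_diag => /eqP.
rewrite addr_eq0 => /eqP e; rewrite -mulr_suml.
rewrite (eq_bigr (fun j => - ((A i j)%:~R * (a j)%:R))) => [|j _]; last by rewrite mulNr.
by rewrite sumrN -e mulfK // gt_eqF // a_gt0.
Qed.

Lemma arc_weight_pair i j : i != j ->
  (adj i j).*2%:R <= arc_weight i j + arc_weight j i /\
  (arc_weight i j + arc_weight j i <= (adj i j).*2%:R -> A i j = A j i).
Proof.
move=> ij; rewrite /adj ij /=; have [A0|A0] := eqVneq (A i j) 0.
  have /eqP A0' : A j i == 0 by rewrite -gcm_eq0C A0.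
  by rewrite /arc_weight A0 A0' !(oppr0, mul0r) addr0.
have ge1 k l : k != l -> A k l != 0 -> 1 <= - (A k l)%:~R :> R.
  move=> kl Akl; rewrite -(rmorphN intr) -(rmorph1 intr) ler_int.
  by rewrite -gtz0_ge1 oppr_gt0 lt_neqAle Akl gcm_offdiag.
have A0' : A j i != 0 by rewrite -gcm_eq0C.
have t0 : 0 < (a j)%:R / (a i)%:R :> R by rewrite divr_gt0 ?a_gt0.
have [] := weighted_ge2 t0 (ge1 _ _ ij A0) (ge1 j i _ A0'); first by rewrite eq_sym.
rewrite invf_div !mulrA => le2 eq2; split=> //.
move=> /eq2 [e1 e2]; apply: (@intr_inj R); apply: oppr_inj.
by rewrite e1 e2.
Qed.

(** Summed over ordered pairs, [arc_weight i j + arc_weight j i] totals [4 (n + 1)], and each arc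
    consumes at least 2. With [2 (n + 1)] arcs nothing is left over, so every pair is in the
    equality case of [arc_weight_pair]. *)
Lemma many_arcs_symmetric : (n.+1.*2 <= arcs [set: 'I_n.+1])%N ->
  forall i j, A i j = A j i.
Proof.
move=> many.
pose W i j := arc_weight i j + arc_weight j i - (adj i j).*2%:R.
have W0 i j : i != j -> 0 <= W i j.
  by move=> /arc_weight_pair [h _]; rewrite subr_ge0.
have sw : \sum_i \sum_(j | j != i) arc_weight i j = n.+1.*2%:R :> R.
  rewrite (eq_bigr (fun=> 2)) => [|i _]; last exact: sum_arc_weight.
  by rewrite sumr_const card_ord -muln2 natrM mulr_natl.
have sw' : \sum_i \sum_(j | j != i) arc_weight j i = n.+1.*2%:R :> R.
  rewrite -sw (exchange_big_dep predT) //=; apply: eq_bigr => i _.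
  by apply: eq_bigl => j; rewrite eq_sym.
have sa : \sum_i \sum_(j | j != i) (adj i j).*2%:R = (arcs [set: 'I_n.+1]%SET).*2%:R :> R.
  rewrite /arcs -muln2 natrM natr_sum big_distrl /=.
  apply: eq_big => [i|i _]; first by rewrite inE.
  rewrite natr_sum big_distrl /= [RHS](bigD1 i) ?inE //= adjii mul0r add0r.
  by apply: eq_big => [j|j _]; rewrite ?inE // -muln2 natrM.
have sW : \sum_i \sum_(j | j != i) W i j <= 0.
  rewrite /W; under eq_bigr do rewrite !big_split /= sumrN.
  rewrite !big_split /= sumrN sw sw' sa -natrD subr_le0 ler_nat.
  by rewrite addnn leq_double.
have Wij0 i j : j != i -> W i j = 0.
  move=> ji; have r0 k : 0 <= \sum_(l | l != k) W k l.
    by apply: sumr_ge0 => l lk; rewrite W0 // eq_sym.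
  have /eqP : \sum_i \sum_(j | j != i) W i j = 0.
    by apply/eqP; rewrite eq_le sW sumr_ge0.
  rewrite psumr_eq0 // => /allP /(_ i (mem_index_enum _)) /=.
  rewrite psumr_eq0 => [|l lk]; last by rewrite W0 // eq_sym.
  by move=> /allP /(_ j (mem_index_enum _)); rewrite ji => /eqP.
move=> i j; have [->//|ij] := eqVneq i j.
apply: (arc_weight_pair ij).2; rewrite -subr_le0 -/(W i j) Wij0 //.
by rewrite eq_sym.
Qed.

Definition symmetrizes (d : 'I_n.+1 -> R) (J : {set 'I_n.+1}) :=
  (forall i, 0 < d i) /\
  {in J &, forall i j, d i * (A i j)%:~R = d j * (A j i)%:~R}.

(** Nodes are attached one at a time along an edge leaving [J]. A new node with a single neighbour
    in [J] lets [d] extend; a second neighbour creates a surplus edge, which persists afterwards. *)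
Lemma grow_tree k : (k <= n)%N -> exists J : {set 'I_n.+1}, #|J| = k.+1 /\
  ((k.*2 <= arcs J)%N /\ (exists d, symmetrizes d J) \/ (k.+1.*2 <= arcs J)%N).
Proof.
elim: k => [|k IH] kn.
  exists [set ord0]; rewrite cards1; split=> //; left; split=> //.
  exists (fun=> 1); split=> // i j; rewrite !inE => /eqP -> /eqP ->; first exact.
have [J [cJ PJ]] := IH (ltnW kn).
have J0 : J != finset.set0 by rewrite -cards_eq0 cJ.
have JT : J != [set: 'I_n.+1]%SET.
  apply: contraTneq kn => JT; move: cJ; rewrite JT cardsT card_ord => -[->].
  by rewrite ltnn.
have [i [j [iJ jJ Aij]]] := A_indec J0 JT.
have ij : i != j by apply: contraNneq jJ => <-.
have adj1 : adj j i = 1%N by rewrite adjC /adj ij Aij.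
exists (j |: J); rewrite cardsU1 jJ cJ; split=> //; rewrite arcsU1 //.
rewrite (bigD1 i) //= adj1.
(* [m] counts the neighbours of [j] in [J] other than [i]. *)
set m := (\sum_(_ in J | _) _)%N.
case: PJ => [[arcsJ [d [d0 dJ]]]|arcsJ]; last first.
  by right; lia.
have [m0|m_gt0] := posnP m; last first.
  by right; lia.
left; split; first by lia.
have adj0 l : l \in J -> l != i -> A j l = 0 /\ A l j = 0.
  move=> lJ li; move: m0 => /eqP; rewrite sum_nat_eq0 => /forallP /(_ l).
  have jl : j != l by apply: contraNneq jJ => ->.
  rewrite lJ li /adj jl /= eqb0 negbK => /eqP Ajl; split=> //.
  by apply/eqP; rewrite -gcm_eq0C Ajl.
have Aji0 : (A j i)%:~R != 0 :> R by rewrite intr_eq0 -gcm_eq0C.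
(* The value at [j] is forced by the symmetry condition on the edge joining [i] and [j]. *)
exists (fun x => if x == j then d i * (A i j)%:~R / (A j i)%:~R else d x).
split=> [x|x y].
  case: ifP => // _; rewrite -mulrA mulr_gt0 //.
  rewrite -[X in 0 < X]mulrNN -invrN divr_gt0 // oppr_gt0 ltrz0 lt_neqAle.
    by rewrite Aij gcm_offdiag.
  by rewrite -gcm_eq0C Aij gcm_offdiag // eq_sym.
have cross l : l \in J -> d i * (A i j)%:~R / (A j i)%:~R * (A j l)%:~R =
    d l * (A l j)%:~R.
  move=> lJ; have [->|li] := eqVneq l i; first by rewrite mulfVK.
  by have [-> ->] := adj0 _ lJ li; rewrite !mulr0.
have neJ l : l \in J -> (l == j) = false.
  by move=> lJ; apply: contraNF jJ => /eqP <-.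
rewrite !inE => /orP [/eqP ->|xJ] /orP [/eqP ->|yJ] //.
- by rewrite eqxx neJ // cross.
- by rewrite eqxx neJ // -cross.
- by rewrite !neJ // dJ.
Qed.

Lemma symmetrizable : exists d : 'I_n.+1 -> R, (forall i, 0 < d i) /\
  forall i j, d i * (A i j)%:~R = d j * (A j i)%:~R.
Proof.
have [J [cJ]] := grow_tree (leqnn n).
have -> : J = [set: 'I_n.+1]%SET.
  by apply/eqP; rewrite eqEcard finset.subsetT cardsT card_ord cJ leqnn.
case=> [[_ [d [d0 dT]]]|/many_arcs_symmetric symA].
  by exists d; split=> // i j; apply: dT; rewrite inE.
by exists (fun=> 1); split=> // i j; rewrite symA.
Qed.

End Symmetrizability.

(** * Finite coroots in coordinates *)

Section CorootLattice.
Context (R : realType) (n : nat) (A : 'M[int]_n.+1) (a : 'I_n.+1 -> nat).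
Hypothesis A_gcm : generalized_cartan A.
Hypothesis A_indec : indecomposable A.
Hypothesis a_delta : delta_coefficients A a.
Context (d : 'I_n.+1 -> R).
Hypothesis d_gt0 : forall i, 0 < d i.
Hypothesis d_sym : forall i j, d i * (A i j)%:~R = d j * (A j i)%:~R.

Local Notation V := 'rV[R]_n.+1.
Local Notation e k := (delta_mx 0 k : V).
Local Notation M := (Defs.realmx R A).

Lemma d_neq0 i : d i != 0. Proof. by rewrite gt_eqF. Qed.

(* A row [c] stands for the combination [sum_i c_i alpha_i^vee] of coroots, that
   is, for [c *m M] in [h]; [act1 i] is [s_i] read on these coefficients. *)
Definition act1 (i : 'I_n.+1) (c : V) : V := c - (c *m M) 0 i *: e i.

Definition act (l : seq 'I_n.+1) (c : V) : V := foldr act1 c l.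

Lemma act1B i c c' : act1 i (c - c') = act1 i c - act1 i c'.
Proof.
apply/rowP => j; rewrite /act1 mulmxBl !mxE; ring.
Qed.

Lemma act1Z i x c : act1 i (x *: c) = x *: act1 i c.
Proof. by rewrite /act1 -scalemxAl mxE scalerBr scalerA. Qed.

Lemma actB l c c' : act l (c - c') = act l c - act l c'.
Proof. by elim: l => //= i l ->; rewrite act1B. Qed.

Lemma actZ l x c : act l (x *: c) = x *: act l c.
Proof. by elim: l => //= i l ->; rewrite act1Z. Qed.

Lemma act_cat l l' c : act (l ++ l') c = act l (act l' c).
Proof. exact: foldr_cat. Qed.

Lemma act_rcons l i c : act (rcons l i) c = act l (act1 i c).
Proof. exact: foldr_rcons. Qed.

(** * The invariant form and its definiteness *)

Definition gram : 'M[R]_n.+1 := \matrix_(i, j) ((A i j)%:~R / d j).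

Definition form (c c' : V) : R := (c *m gram *m c'^T) 0 0.

Lemma gramC i j : gram i j = gram j i.
Proof.
rewrite !mxE; apply: (mulfI (d_neq0 i)); apply: (mulIf (d_neq0 j)).
rewrite mulrA mulfVK ?d_neq0 // d_sym; field; exact: d_neq0.
Qed.

Lemma formC c c' : form c c' = form c' c.
Proof.
have gT : gram^T = gram by apply/matrixP => i j; rewrite [LHS]mxE gramC.
rewrite /form; have <- : (c *m gram *m c'^T)^T = c' *m gram *m c^T.
  by rewrite !trmx_mul trmxK gT mulmxA.
by rewrite [RHS]mxE.
Qed.

Lemma formBl c1 c2 c : form (c1 - c2) c = form c1 c - form c2 c.
Proof. by rewrite /form !mulmxBl !mxE. Qed.

Lemma formZl x c1 c : form (x *: c1) c = x * form c1 c.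
Proof. by rewrite /form -!scalemxAl mxE. Qed.

Lemma formBr c c1 c2 : form c (c1 - c2) = form c c1 - form c c2.
Proof. by rewrite !(formC c) formBl. Qed.

Lemma formZr x c c1 : form c (x *: c1) = x * form c c1.
Proof. by rewrite !(formC c) formZl. Qed.

Lemma formE c c' : form c c' = \sum_i \sum_j c 0 i * gram i j * c' 0 j.
Proof.
rewrite /form mxE exchange_big /=; apply: eq_bigr => j _.
by rewrite !mxE mulr_suml.
Qed.

(** Hence [d k *: e k] represents the pairing with [alpha_k], which makes [act1 k] an orthogonal
    reflection for [form]. *)
Lemma form_simple c k : form c (e k) = (c *m M) 0 k / d k.
Proof.
rewrite /form trmx_delta -colE !mxE mulr_suml; apply: eq_bigr => i _.
by rewrite !mxE mulrA.
Qed.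

Lemma act1E i c : act1 i c = c - (d i * form c (e i)) *: e i.
Proof. by rewrite /act1 form_simple mulrC divfK // d_neq0. Qed.

Lemma simpleM k j : (e k *m M) 0 j = (A k j)%:~R.
Proof. by rewrite -rowE !mxE. Qed.

Lemma form_simple_simple k : form (e k) (e k) = 2 / d k.
Proof. by rewrite form_simple simpleM gcm_diag. Qed.

Lemma act1_simple k : act1 k (e k) = - e k.
Proof.
by rewrite /act1 simpleM gcm_diag // scalerDl scale1r opprD addrA subrr sub0r.
Qed.

Lemma form_act1 k c c' : form (act1 k c) (act1 k c') = form c c'.
Proof.
rewrite !act1E !formBl !formZl !formBr !formZr form_simple_simple (formC (e k)).
field; exact: d_neq0.
Qed.

Lemma act1K k : involutive (act1 k).
Proof.
by move=> c; rewrite {2}/act1 act1B act1Z act1_simple scalerN opprK {1}/act1 subrK.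
Qed.

Lemma form_act l c c' : form (act l c) (act l c') = form c c'.
Proof. by elim: l => //= k l IH; rewrite form_act1. Qed.

(** An orthogonal reflection is determined by its coroot: invariance of the norm gives [d i = d k],
    and invariance of [form] transports the coefficient. *)
Lemma act_conj l i k c : act l (e i) = e k ->
  act1 k (act l c) = act l (act1 i c).
Proof.
move=> lik; have eid : d i = d k.
  apply: invr_inj; apply: (@mulfI _ 2); first by rewrite pnatr_eq0.
  by rewrite -!form_simple_simple -lik form_act.
by rewrite !act1E actB actZ lik -{1}lik form_act eid.
Qed.

(* [kappa] spans the radical of [form]. *)
Definition kappa i : R := d i * (a i)%:R.

Lemma kappa_gt0 i : 0 < kappa i.
Proof. by rewrite mulr_gt0 // (a_gt0 R a_delta). Qed.

Lemma sum_gram_kappa i : \sum_j gram i j * kappa j = 0.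
Proof.
rewrite -[RHS](sum_a_row R a_delta i); apply: eq_bigr => j _.
by rewrite mxE /kappa mulrA divfK ?d_neq0.
Qed.

Definition form_term (c : V) i j : R :=
  - gram i j * kappa i * kappa j * (c 0 i / kappa i - c 0 j / kappa j) ^+ 2.

(** Once the squares are expanded, the pure terms sum to zero because [kappa] lies in the radical;
    the mixed terms give twice the form. *)
Lemma form_sum_squares c : form c c = 2^-1 * \sum_i \sum_j form_term c i j.
Proof.
have k0 i : kappa i != 0 by rewrite gt_eqF ?kappa_gt0.
have [X XE] : exists X, forall i j,
    X i j = c 0 i ^+ 2 / kappa i * (gram i j * kappa j) by eexists.
have X0 : \sum_i \sum_j X i j = 0.
  apply: big1 => i _; under eq_bigr do rewrite XE.
  by rewrite -mulr_sumr sum_gram_kappa mulr0.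
have X0' : \sum_i \sum_j X j i = 0 by rewrite exchange_big.
have -> : \sum_i \sum_j form_term c i j =
    \sum_i \sum_j (c 0 i * gram i j * c 0 j) *+ 2.
  have E i j : form_term c i j =
      (c 0 i * gram i j * c 0 j) *+ 2 - (X i j + X j i).
    by rewrite /form_term !XE (gramC j i); field; rewrite !k0.
  have E' i : \sum_j form_term c i j =
      \sum_j (c 0 i * gram i j * c 0 j) *+ 2 - (\sum_j X i j + \sum_j X j i).
    by rewrite -big_split -sumrB; apply: eq_bigr => j _; rewrite E.
  under eq_bigr do rewrite E'.
  by rewrite sumrB [X in _ - X]big_split /= X0 X0' addr0 subr0.
have -> : \sum_i \sum_j (c 0 i * gram i j * c 0 j) *+ 2 = form c c *+ 2.
  by rewrite formE -sumrMnl; apply: eq_bigr => i _; rewrite sumrMnl.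
by rewrite -[form c c *+ 2]mulr_natl mulKf // pnatr_eq0.
Qed.

Lemma gram_offdiag i j : i != j -> gram i j <= 0.
Proof.
move=> ij; rewrite mxE; apply: mulr_le0_ge0; first by rewrite lerz0 gcm_offdiag.
by rewrite invr_ge0 ltW.
Qed.

Lemma form_term_ge0 c i j : 0 <= form_term c i j.
Proof.
have [<-|ij] := eqVneq i j; first by rewrite /form_term subrr expr0n mulr0.
have k0 k := ltW (kappa_gt0 k).
apply: (mulr_ge0 _ (sqr_ge0 _)); apply: (mulr_ge0 _ (k0 j)).
by apply: (mulr_ge0 _ (k0 i)); rewrite oppr_ge0 gram_offdiag.
Qed.

(** A bound on one coordinate spreads along each edge, since a single [form_term] is at most [2 N].
    Starting from the zero coordinate at [ord0], indecomposability reaches every node. *)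
Lemma coordinates_bounded (N : R) : exists B : R, forall c : V,
  c 0 ord0 = 0 -> form c c <= N -> forall i, `|c 0 i| <= B.
Proof.
pose P i (B : R) := forall c : V, c 0 ord0 = 0 -> form c c <= N -> `|c 0 i| <= B.
have k0 i : kappa i != 0 by rewrite gt_eqF ?kappa_gt0.
suff /boolp.choice [B hB] : forall i, exists B, P i B.
  exists (\sum_i `|B i|) => c c0 cN i; apply: le_trans (hB i c c0 cN) _.
  rewrite (bigD1 i) //= (le_trans (ler_norm _)) // lerDl.
  by apply: sumr_ge0 => j _; rewrite normr_ge0.
pose J := [set i | `[< exists B, P i B >]]%SET.
suff JT : J = [set: 'I_n.+1]%SET.
  by move=> i; have : i \in J; [rewrite JT inE | rewrite inE => /asboolP].
apply: contrapT => /eqP JT.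
have J0 : J != finset.set0.
  apply/set0Pn; exists ord0; rewrite inE; apply/asboolP; exists 0 => c c0 _.
  by rewrite c0 normr0.
have [i [j [iJ jJ Aij]]] := A_indec J0 JT.
move: iJ jJ; rewrite !inE => -[B hB] Pj; have ij : i != j.
  by apply: contraNneq Pj => <-; apply/asboolP; exists B.
move: Pj => /asboolP; apply; rewrite /P.
pose g := - gram i j * kappa i * kappa j.
have g0 : 0 < g.
  apply: (mulr_gt0 _ (kappa_gt0 j)); apply: (mulr_gt0 _ (kappa_gt0 i)).
  rewrite oppr_gt0 lt_neqAle gram_offdiag // andbT.
  by rewrite mxE mulf_neq0 ?invr_neq0 ?intr_eq0 ?d_neq0.
(* The inequality [|z| <= 1 + z^2] avoids a square root when bounding the difference [z] of the
   rescaled coordinates. *)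
exists ((B / kappa i + (1 + 2 * N / g)) * kappa j) => c c0 cN.
have ci := hB c c0 cN.
set z := c 0 i / kappa i - c 0 j / kappa j.
have zN : z ^+ 2 <= 2 * N / g.
  rewrite ler_pdivlMr // mulrC -/(form_term c i j).
  apply: le_trans (_ : 2 * form c c <= _); last by rewrite ler_pM2l.
  rewrite form_sum_squares mulVKf ?pnatr_eq0 //.
  rewrite (bigD1 i) //= (bigD1 j) //= -addrA lerDl addr_ge0 //.
    by apply: sumr_ge0 => *; rewrite form_term_ge0.
  by do 2!(apply: sumr_ge0 => * ); rewrite form_term_ge0.
rewrite -ler_pdivrMr ?kappa_gt0 //.
have -> : `|c 0 j| / kappa j = `|c 0 i / kappa i - z|.
  by rewrite /z opprB addrC subrK normrM [X in _ = _ * X]gtr0_norm // invr_gt0 kappa_gt0.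
apply: le_trans (ler_normB _ _) _; apply: lerD.
  rewrite normrM [X in _ * X]gtr0_norm ?invr_gt0 ?kappa_gt0 //.
  by rewrite ler_pM2r // invr_gt0 kappa_gt0.
apply: le_trans (lerD (lexx 1) zN); rewrite -real_normK ?num_real //.
have := sqr_ge0 (`|z| - 1); rewrite sqrrB expr1n mulr1 => h.
have := normr_ge0 z; lra.
Qed.

(** All multiples of an isotropic [c] obey the same coordinate bound [B]; a nonzero coordinate could
    be scaled to [|B| + 1]. *)
Lemma form_posdef (c : V) : c 0 ord0 = 0 -> form c c = 0 -> c = 0.
Proof.
move=> c0 cc; have [B hB] := coordinates_bounded 0.
apply/rowP => i; rewrite mxE; apply: contrapT => /eqP ci.
have := hB ((`|B| + 1) / `|c 0 i| *: c).
rewrite formZl formZr cc !mulr0 mxE c0 mulr0 => /(_ erefl (lexx _) i).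
rewrite mxE normrM normf_div normr_id divfK ?normr_eq0 //.
rewrite ger0_norm ?addr_ge0 ?normr_ge0 //.
have := ler_norm B; lra.
Qed.

Lemma form_ge0 (c : V) : 0 <= form c c.
Proof.
rewrite form_sum_squares mulr_ge0 ?invr_ge0 ?ler0n //.
by apply: sumr_ge0 => i _; apply: sumr_ge0 => j _; exact: form_term_ge0.
Qed.

(* A lattice stable under the finite Weyl group and containing the orbit of the
   [j]-th simple coroot, whose norm [2 / d j] is the minimal norm of the lattice. *)
Definition in_lattice j (c : V) : Prop :=
  [/\ c 0 ord0 = 0, forall i, c 0 i \is a Num.int
    & forall i, c 0 i * d j / d i \is a Num.int].

Lemma in_lattice_simple j : j != ord0 -> in_lattice j (e j).
Proof.
move=> j0; split=> [|i|i]; rewrite !mxE !eqxx ?[_ == j]eq_sym.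
- by rewrite (negPf j0).
- by rewrite rpred_nat.
- have [<-|_] := eqVneq j i; last by rewrite !mul0r rpred0.
  by rewrite mul1r divff ?d_neq0 ?rpred1.
Qed.

Lemma in_lattice_act1 j k c : k != ord0 -> in_lattice j c -> in_lattice j (act1 k c).
Proof.
move=> k0 [c0 cZ cdZ].
have cE i : act1 k c 0 i = c 0 i - (i == k)%:R * (c *m M) 0 k.
  by rewrite !mxE eqxx mulrC.
split=> [|i|i]; rewrite cE.
- by rewrite c0 [_ == k]eq_sym (negPf k0) mul0r subrr.
- rewrite rpredB // rpredM ?rpred_nat // mxE rpred_sum // => m _.
  by rewrite mxE rpredM // intr_int.
- rewrite -mulrA mulrBl mulrA rpredB //.
  have [->|_] := eqVneq i k; last by rewrite !mul0r rpred0.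
  rewrite mul1r mxE mulr_suml rpred_sum // => m _.
  (* Symmetry of [gram] trades the factor [d j / d k] for [d j / d m], which the third lattice
     condition makes integral. *)
  have -> : c 0 m * M m k * (d j / d k) = c 0 m * d j / d m * (A k m)%:~R.
    rewrite mxE; have := gramC m k; rewrite !mxE => e.
    have -> : (A m k)%:~R = (A k m)%:~R / d m * d k :> R by rewrite -e divfK ?d_neq0.
    by field; rewrite !d_neq0.
  by rewrite rpredM // intr_int.
Qed.

Lemma sum_symmetric (t : 'I_n.+1 -> 'I_n.+1 -> R) : (forall i j, t i j = t j i) ->
  \sum_i \sum_j t i j =
  \sum_i t i i + 2 * \sum_(i < n.+1) \sum_(j : 'I_n.+1 | (j < i)%N) t i j.
Proof.
move=> tC; pose U := \sum_(i < n.+1) \sum_(j : 'I_n.+1 | (i < j)%N) t i j.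
have UE : U = \sum_(i < n.+1) \sum_(j : 'I_n.+1 | (j < i)%N) t i j.
  rewrite /U (exchange_big_dep predT) //=; apply: eq_bigr => i _.
  by apply: eq_bigr => j _.
rewrite mulr2n mulrDl mul1r -{1}UE -!big_split /=; apply: eq_bigr => i _.
rewrite (bigD1 i) //= (bigID (fun j : 'I_n.+1 => (i < j)%N)) /=.
congr (_ + (_ + _)); apply: eq_bigl => j.
  by rewrite andbC; case: (ltngtP i j) => //= ij; rewrite -(inj_eq val_inj) gtn_eqF.
by rewrite -leqNgt -(inj_eq val_inj) /= ltn_neqAle.
Qed.

(** The off-diagonal terms occur in equal pairs and the diagonal ones carry [A i i = 2], so the
    rescaled norm is an even integer. *)
Lemma lattice_norm j c : in_lattice j c ->
  exists2 z : R, z \is a Num.int & form c c * d j = 2 * z.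
Proof.
move=> [c0 cZ cdZ].
pose t i k := c 0 i * gram i k * c 0 k * d j.
have tE i k : t i k = c 0 i * (A i k)%:~R * (c 0 k * d j / d k).
  by rewrite /t mxE; field; rewrite d_neq0.
have tC i k : t i k = t k i by rewrite /t gramC; ring.
have -> : form c c * d j = \sum_i \sum_k t i k.
  by rewrite formE mulr_suml; apply: eq_bigr => i _; rewrite mulr_suml.
exists (\sum_i c 0 i * (c 0 i * d j / d i) +
        \sum_(i < n.+1) \sum_(k : 'I_n.+1 | (k < i)%N) t i k); last first.
  rewrite sum_symmetric // mulrDr mulr_sumr; congr (_ + _).
  by apply: eq_bigr => i _; rewrite tE gcm_diag //; ring.
rewrite rpredD ?rpred_sum // => i _; first by rewrite rpredM.
by rewrite rpred_sum // => k _; rewrite tE rpredM ?cdZ // rpredM ?cZ ?intr_int.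
Qed.

Lemma lattice_min j c : in_lattice j c -> c != 0 -> 2 / d j <= form c c.
Proof.
move=> Lc c_neq0; have [z zZ zE] := lattice_norm Lc.
have [c0 _ _] := Lc; rewrite ler_pdivrMr // zE ler_peMr //.
have z0 : 0 <= z.
  by rewrite -(@pmulr_rge0 _ 2) // -zE mulr_ge0 ?form_ge0 // ltW.
rewrite -(ger0_norm z0) norm_intr_ge1 //.
apply: contraNneq c_neq0 => z_eq0; apply/eqP/form_posdef => //.
by move/eqP: zE; rewrite z_eq0 mulr0 mulf_eq0 (negPf (d_neq0 j)) orbF => /eqP.
Qed.

(** * Finite coroots, their signs and their finiteness *)

Definition is_coroot (c : V) : Prop := exists l j,
  [/\ all (predC1 ord0) l, j != ord0 & c = act l (e j)].

Lemma act_0 l (c : V) : all (predC1 ord0) l -> c 0 ord0 = 0 -> act l c 0 ord0 = 0.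
Proof.
move=> + c0; elim: l => //= i l IH /andP [i0 /IH h].
by rewrite !mxE h [_ == i]eq_sym (negPf i0) andbF mulr0 subr0.
Qed.

Lemma coroot_0 c : is_coroot c -> c 0 ord0 = 0.
Proof.
move=> [l [j [l0 j0 ->]]]; apply: act_0 => //.
by rewrite mxE [_ == j]eq_sym (negPf j0) andbF.
Qed.

Lemma coroot_lattice c : is_coroot c ->
  exists j, [/\ j != ord0, in_lattice j c & form c c = 2 / d j].
Proof.
move=> [l [j [l0 j0 ->]]]; exists j; split=> //.
  elim: l l0 => /= [_|k l IH /andP [k0 /IH]]; first exact: in_lattice_simple.
  exact: in_lattice_act1.
by rewrite form_act form_simple_simple.
Qed.

Lemma coroot_sign c : is_coroot c -> (forall i, 0 <= c 0 i) \/ (forall i, c 0 i <= 0).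
Proof.
move=> /coroot_lattice [j [_ [c0 cZ cdZ] cc]].
(* [c = p - m] and [form p m <= 0], so [c] has at least the norm of [p] plus that
   of [m]; if neither vanishes, this is twice the minimal norm of the lattice. *)
pose p : V := \row_i Num.max (c 0 i) 0.
pose m : V := \row_i Num.max (- c 0 i) 0.
have cE : c = p - m.
  by apply/rowP => i; rewrite !mxE; case: (lerP (c 0 i) 0); case: (lerP (- c 0 i) 0); lra.
have Lp : in_lattice j p.
  split=> [|i|i]; rewrite mxE.
  - by rewrite c0 maxxx.
  - by case: lerP; rewrite ?rpred0.
  - by case: lerP; rewrite ?mul0r ?rpred0.
have Lm : in_lattice j m.
  split=> [|i|i]; rewrite mxE.
  - by rewrite c0 oppr0 maxxx.
  - by case: lerP; rewrite ?rpredN ?rpred0.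
  - by case: lerP; rewrite ?mulNr ?rpredN ?mul0r ?rpred0.
(* Diagonal terms vanish because [p] and [m] have disjoint supports; the others are nonpositive
   because the off-diagonal entries of [gram] are. *)
have pm : form p m <= 0.
  rewrite formE; apply: sumr_le0 => i _; apply: sumr_le0 => k _.
  have [<-|ik] := eqVneq i k.
    rewrite !mxE mulrAC; case: (lerP (c 0 i) 0) => ci; first by rewrite !mul0r.
    by case: (lerP (- c 0 i) 0) => ci'; [rewrite mulr0 mul0r | lra].
  rewrite mulrAC; apply: mulr_ge0_le0; last exact: gram_offdiag.
  by apply: mulr_ge0; rewrite mxE le_max lexx orbT.
have := cc; rewrite {1 2}cE formBl !formBr (formC m p) => cc'.
have [p0|p0] := eqVneq p 0.
  right=> i; rewrite cE p0 sub0r !mxE oppr_le0.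
  by rewrite le_max lexx orbT.
have [m0|m0] := eqVneq m 0.
  left=> i; by rewrite cE m0 subr0 mxE le_max lexx orbT.
have := lattice_min Lp p0; have := lattice_min Lm m0.
have : 0 < 2 / d j by rewrite divr_gt0.
lra.
Qed.

(** Comparing norms for [c = x *: e k] gives [x * (x * d j / d k) = 1], a product of two integers,
    so [x] is a unit; being nonnegative, it is 1. *)
Lemma coroot_reduced c k : is_coroot c -> (forall i, 0 <= c 0 i) ->
  (forall i, i != k -> c 0 i = 0) -> c = e k.
Proof.
move=> /coroot_lattice [j [_ [c0 cZ cdZ] cc]] c_ge0 ck.
have cE : c = c 0 k *: e k.
  apply/rowP => i; rewrite !mxE eqxx; have [->|/ck ->] := eqVneq i k.
    by rewrite mulr1.
  by rewrite mulr0.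
have : c 0 k * (c 0 k * d j / d k) = 1.
  have : form (c 0 k *: e k) (c 0 k *: e k) = 2 / d j by rewrite -cE.
  rewrite formZl formZr form_simple_simple => {}cc.
  apply: (mulfI (_ : 2 / d j != 0)).
    by rewrite mulf_neq0 ?invr_neq0 ?d_neq0 ?pnatr_eq0.
  by rewrite mulr1 -[RHS]cc; field; rewrite !d_neq0.
rewrite [in X in _ -> X]cE; have := c_ge0 k.
have /intrP [y ->] := cdZ k; have /intrP [x ->] := cZ k.
rewrite ler0z -(rmorphM intr) -(rmorph1 intr) => x0 /intr_inj xy.
have : (absz x * absz y)%N == 1%N by rewrite -abszM xy.
by rewrite muln_eq1 => /andP [/eqP x1 _]; rewrite -(gez0_abs x0) x1 scale1r.
Qed.

Lemma act1D i c c' : act1 i (c + c') = act1 i c + act1 i c'.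
Proof. by rewrite /act1 mulmxDl mxE scalerDl opprD addrACA. Qed.

Lemma act1_sum i (s : seq V) : act1 i (\sum_(c <- s) c) = \sum_(c <- s) act1 i c.
Proof.
elim: s => [|c s IH]; last by rewrite !big_cons act1D IH.
by rewrite !big_nil /act1 mul0mx mxE scale0r subr0.
Qed.

Lemma coroot_act1 k c : k != ord0 -> is_coroot c -> is_coroot (act1 k c).
Proof.
move=> k0 [l [j [l0 j0 ->]]]; exists (k :: l), j; split=> //=.
by rewrite k0.
Qed.

Lemma coroot_simple k : k != ord0 -> is_coroot (e k).
Proof. by exists [::], k. Qed.

Lemma simple_ge0 k i : 0 <= e k 0 i.
Proof. by rewrite mxE ler0n. Qed.

(** The reflection changes only coordinate [k]. If the image were nonpositive, all other coordinates
    of [c] would vanish, and [coroot_reduced] would give [c = e k]. *)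
Lemma positive_act1 k c : k != ord0 -> is_coroot c ->
  (forall i, 0 <= c 0 i) -> c != e k -> forall i, 0 <= act1 k c 0 i.
Proof.
move=> k0 cR c_ge0 /eqP ck.
case: (coroot_sign (coroot_act1 k0 cR)) => // kc_le0; case: ck.
apply: coroot_reduced => // i ik; apply/eqP; rewrite eq_le c_ge0 andbT.
by have := kc_le0 i; rewrite !mxE (negPf ik) andbF mulr0 oppr0 addr0.
Qed.

Lemma finite_half_integral (B : R) : finite_set
  [set c : V | (forall i, 2 * c 0 i \is a Num.int) /\ forall i, `|c 0 i| <= B]%classic.
Proof.
pose K := Num.bound (2 * B).
(* The shift by [K] turns the integer [2 * c 0 i], which lies between [-K] and [K], into an index
   from 0 to [2 K]. *)
pose F (f : {ffun 'I_n.+1 -> 'I_(K + K).+1}) : V :=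
  \row_i (((f i)%:R - K%:R) / 2).
apply: (@sub_finite_set _ _ (F @` setT)%classic); last exact/finite_image/finite_finset.
move=> c [cZ cB]; exists [ffun i => inord (absz (Num.floor (2 * c 0 i) + K%:Z))] => //.
apply/rowP => i; rewrite !mxE ffunE.
have zE := floorK (cZ i); set z := Num.floor _ in zE *.
have zB : `|z%:~R| <= K%:R :> R.
  rewrite zE normrM ger0_norm //; apply: le_trans (_ : 2 * B <= _).
    by rewrite ler_pM2l.
  apply: ltW; apply: archi_boundP; rewrite mulr_ge0 //.
  exact: le_trans (cB i).
have {}zB : `|z| <= K%:Z by rewrite -(ler_int R) intr_norm.
move: zB; rewrite ler_norml => /andP [z1 z2].
clearbody z; rewrite inordK; last by clear -z1 z2; lia.
have -> : (absz (z + K%:Z))%:R = z%:~R + K%:R :> R.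
  rewrite -[K%:R]/(K%:Z%:~R) -rmorphD /= -[LHS]/((Posz (absz _))%:~R).
  by rewrite gez0_abs //; clear -z1 z2; lia.
by rewrite zE addrK mulrC mulKf ?pnatr_eq0.
Qed.

Lemma positive_coroot_seq : exists P : seq V, uniq P /\
  forall c, c \in P <-> is_coroot c /\ forall i, 0 <= c 0 i.
Proof.
(* A coroot has norm [2 / d j] for some [j], so this sum bounds the norms of all coroots at once. *)
pose N := \sum_i 2 / d i.
have [B hB] := coordinates_bounded N.
have : finite_set [set c : V | is_coroot c /\ forall i, 0 <= c 0 i]%classic.
  apply: sub_finite_set (finite_half_integral B) => c [/coroot_lattice [j []]].
  move=> j0 [c0 cZ _] cc _; split=> i; first by rewrite rpredM ?rpred_nat.
  apply: hB => //; rewrite cc /N (bigD1 j) //= lerDl.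
  by apply: sumr_ge0 => k _; rewrite divr_ge0 ?ltW.
move=> /finite_seqP [P PE]; exists (undup P); split; first exact: undup_uniq.
move=> c; rewrite mem_undup.
by have /= := congr1 (fun S : classical_sets.set V => S c) PE; move=> <-.
Qed.

(** * The half sum of positive coroots and its stabilizer *)

Section DominantVector.
Context (P : seq V).
Hypothesis P_uniq : uniq P.
Hypothesis P_spec : forall c, c \in P <-> is_coroot c /\ forall i, 0 <= c 0 i.

Definition rho : V := 2^-1 *: \sum_(c <- P) c.

Lemma rho0 : rho 0 ord0 = 0.
Proof.
by rewrite mxE summxE big_seq big1 ?mulr0 // => c /P_spec [/coroot_0].
Qed.

Lemma rho_half_integral i : 2 * rho 0 i \is a Num.int.
Proof.
rewrite mxE mulVKf ?pnatr_eq0 // summxE big_seq rpred_sum // => c.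
by move=> /P_spec [/coroot_lattice [j [_ []]]].
Qed.

(** The reflection permutes the positive coroots other than [e k] and negates [e k]. *)
Lemma act1_rho k : k != ord0 -> act1 k rho = rho - e k.
Proof.
move=> k0; have kP : e k \in P.
  by apply/P_spec; split; [exact: coroot_simple | exact: simple_ge0].
have Q_uniq : uniq (rem (e k) P) by rewrite rem_uniq.
have inQ c : c \in rem (e k) P -> act1 k c \in rem (e k) P.
  rewrite !(mem_rem_uniq _ P_uniq) !inE => /andP [ck /P_spec [cR c_ge0]].
  apply/andP; split; last first.
    by apply/P_spec; split; [exact: coroot_act1 | exact: positive_act1].
  apply/eqP => /(congr1 (act1 k)); rewrite act1K act1_simple => cE.
  by have := c_ge0 k; rewrite cE !mxE !eqxx oppr_ge0 lern0.
have Q_perm : perm_eq (map (act1 k) (rem (e k) P)) (rem (e k) P).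
  apply: uniq_perm => //; first by rewrite (map_inj_uniq (inv_inj (act1K k))).
  move=> c; apply/mapP/idP => [[c' c'Q ->]|cQ]; first exact: inQ.
  by exists (act1 k c); rewrite ?act1K //; exact: inQ.
rewrite /rho act1Z (perm_big _ (perm_to_rem kP)) /= big_cons act1D act1_sum.
rewrite act1_simple -[in LHS](big_map (act1 k) predT id) (perm_big _ Q_perm) /=.
by apply/rowP => i; rewrite !mxE; field.
Qed.

(** Applying the letters of [l] from the right, some letter [k] first makes the image of [e i] lose
    positivity. By [positive_act1] that image is then [e k], and [act_conj] cancels this letter
    against the final [i]. *)
Lemma exchange l i : all (predC1 ord0) l -> i != ord0 ->
  ~ (forall j, 0 <= act l (e i) 0 j) ->
  exists l', [/\ (size l' < size l)%N, all (predC1 ord0) l'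
    & forall c, act (rcons l i) c = act l' c].
Proof.
elim: l => [|k l IH] /= => [_ _ /(_ (simple_ge0 i))//|/andP [k0 l0] i0 neg].
have [pos|npos] := boolp.EM (forall j, 0 <= act l (e i) 0 j); last first.
  have [l' [sl' l'0 l'E]] := IH l0 i0 npos.
  by exists (k :: l'); split=> [||c] /=; rewrite ?k0 // l'E.
exists l; split=> // c; have cR : is_coroot (act l (e i)) by exists l, i.
have [lik|lik] := eqVneq (act l (e i)) (e k).
  by rewrite act_rcons (act_conj _ lik) act1K.
by case: neg; exact: positive_act1.
Qed.

(** Induction on length. A last letter [i] after a prefix [p] subtracts [act p (e i)] from
    [act p rho]: if this coroot is positive the bound persists, and otherwise [exchange] yields a
    shorter word. *)
Lemma act_rho_le l : all (predC1 ord0) l ->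
  (forall i, act l rho 0 i <= rho 0 i) /\
  (act l rho = rho -> forall c, act l c = c).
Proof.
have [m] := ubnP (size l); elim: m l => // m IH l; rewrite ltnS.
case/lastP: l => // p i; rewrite size_rcons all_rcons => pm /andP [i0 p0].
have [pos|neg] := boolp.EM (forall j, 0 <= act p (e i) 0 j); last first.
  have [l' [sl' l'0 l'E]] := exchange p0 i0 neg.
  have [] := IH l' (ltn_trans sl' pm) l'0; rewrite !l'E => le1 fix1.
  by split=> // /fix1 h c; rewrite l'E h.
have [le1 _] := IH p pm p0; rewrite act_rcons act1_rho // actB.
split=> [j|eq_rho].
  rewrite [X in X <= _]mxE [X in _ + X <= _]mxE.
  by have := le1 j; have := pos j; lra.
have p_eq0 : act p (e i) = 0.
  apply/rowP => j; rewrite mxE; apply/eqP; rewrite eq_le pos andbT.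
  have := congr1 (fun x : V => x 0 j) eq_rho.
  by rewrite [LHS]mxE [X in _ + X = _]mxE; have := le1 j; lra.
(* Equality is impossible in the positive case: a vanishing image would have norm 0 rather than
   [2 / d i]. *)
have := form_act p (e i) (e i); rewrite p_eq0 form_simple_simple.
rewrite -[0]subr0 formBl subrr => /esym /eqP.
by rewrite mulf_eq0 invr_eq0 (negPf (d_neq0 i)) orbF pnatr_eq0.
Qed.

End DominantVector.

End CorootLattice.

(** * The level zero action *)

(** When the zero net flows are summed over [Y], edges inside [Y] cancel and each edge leading
    outside contributes a nonpositive term. The total is zero, so all these terms vanish. *)
Lemma circulation_closed (R : realDomainType) (I : finType) (T : choiceType)
    (Y : set T) (s : I -> T -> T) (f : I -> T -> R) (w : I -> R) :
    finite_set Y -> (forall i, involutive (s i)) ->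
    (forall i x, f i (s i x) = - f i x) -> (forall i, 0 < w i) ->
    (forall x, \sum_i w i * f i x = 0) ->
    (forall i x, Y x -> 0 < f i x -> Y (s i x)) ->
  forall i x, Y x -> f i x != 0 -> Y (s i x).
Proof.
move=> /finite_seqP [r0 YE] sK fN w0 wf Ystep.
pose r := undup r0; have r_uniq : uniq r := undup_uniq r0.
have Yr x : Y x <-> x \in r by rewrite YE mem_undup.
(* The involution [s i] permutes the points that it keeps in [r] and negates [f i], so this sum
   equals its opposite. *)
have paired i : \sum_(x <- r | s i x \in r) f i x = 0.
  have r'_perm : perm_eq (map (s i) [seq x <- r | s i x \in r])
      [seq x <- r | s i x \in r].
    apply: uniq_perm; rewrite ?(map_inj_uniq (inv_inj (sK i))) ?filter_uniq //.
    move=> x; apply/mapP/idP => [[y + ->]|]; rewrite !mem_filter ?sK.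
      by rewrite andbC.
    by move=> xr; exists (s i x); rewrite ?sK // mem_filter sK andbC.
  rewrite -big_filter; set S := LHS; suff : S = - S by lra.
  rewrite {1}/S -(perm_big _ r'_perm) big_map -sumrN.
  by apply: eq_bigr => x _; rewrite fN.
have f_le0 i x : x \in r -> s i x \notin r -> f i x <= 0.
  move=> xr sxr; rewrite leNgt; apply: contra sxr => fx.
  by apply/Yr; apply: Ystep => //; apply/Yr.
pose S i := \sum_(x <- r | s i x \notin r) f i x.
have S_le0 i : S i <= 0.
  by rewrite /S big_seq_cond sumr_le0 // => x /andP []; exact: f_le0.
have S_sum i : \sum_(x <- r) f i x = S i.
  by rewrite (bigID (fun x => s i x \in r)) /= paired add0r.
have : \sum_i - (w i * S i) = 0.
  rewrite sumrN; apply/eqP; rewrite oppr_eq0; apply/eqP.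
  under eq_bigr do rewrite -S_sum mulr_sumr.
  by rewrite exchange_big big1 // => x _; exact: wf.
move=> S0 i x /Yr xr fx; apply/Yr; apply: contraNT fx => sxr.
have Si0 : S i = 0.
  move/eqP: S0; rewrite psumr_eq0 => [|j _]; last first.
    by rewrite oppr_ge0 mulr_ge0_le0 // ltW.
  move=> /allP /(_ i (mem_index_enum _)); rewrite oppr_eq0 mulf_eq0.
  by rewrite (gt_eqF (w0 i)) => /eqP.
move: Si0 => /eqP; rewrite /S big_seq_cond -oppr_eq0 -sumrN psumr_eq0.
  by move=> /allP /(_ x xr); rewrite xr sxr oppr_eq0.
by move=> y /andP [yr syr]; rewrite oppr_ge0 f_le0.
Qed.

Section LevelZeroOrbit.
Context (R : realType) (n : nat) (A : 'M[int]_n.+1) (a : 'I_n.+1 -> nat).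
Hypothesis A_gcm : generalized_cartan A.
Hypothesis A_indec : indecomposable A.
Hypothesis A_affine : affine_type R A.
Hypothesis a_delta : delta_coefficients A a.
Hypothesis labelling : good_labelling R A a.
Context (d : 'I_n.+1 -> R).
Hypothesis d_gt0 : forall i, 0 < d i.
Hypothesis d_sym : forall i j, d i * (A i j)%:~R = d j * (A j i)%:~R.
Context (P : seq 'rV[R]_n.+1).
Hypothesis P_uniq : uniq P.
Hypothesis P_spec : forall c, c \in P <-> is_coroot A c /\ forall i, 0 <= c 0 i.

Local Notation V := 'rV[R]_n.+1.
Local Notation e k := (delta_mx 0 k : V).
Local Notation M := (Defs.realmx R A).
Local Notation H0 := (subvs_of (h0 R a)).
Local Notation s i := (cl a (refl R A i)).
Local Notation act := (@act R n A).
Local Notation act1 := (@act1 R n A).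

(** * Passing from coefficient rows to vectors of [h0] *)

Definition phi (c : V) : H0 := vsproj (h0 R a) (c *m M).

Lemma span_h0 (c : V) : c *m M \in h0 R a.
Proof. by rewrite mulmx_sum_row rpred_sum // => i _; rewrite rpredZ // coroot_h0. Qed.

Lemma val_phi c : vsval (phi c) = c *m M.
Proof. by rewrite vsprojK // span_h0. Qed.

Lemma phiD c c' : phi (c + c') = phi c + phi c'.
Proof. by rewrite /phi mulmxDl linearD. Qed.

Lemma phiZ x c : phi (x *: c) = x *: phi c.
Proof. by rewrite /phi -scalemxAl linearZ. Qed.

Lemma phi_sum (I : Type) (r : seq I) (Q : pred I) (F : I -> V) :
  phi (\sum_(i <- r | Q i) F i) = \sum_(i <- r | Q i) phi (F i).
Proof.
by apply: (big_morph _ phiD); rewrite /phi mul0mx linear0.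
Qed.

(** The kernel of [M] acting on rows lies in the radical of [form], which is definite on rows
    vanishing at [ord0]. *)
Lemma phi_inj (c c' : V) : c 0 ord0 = 0 -> c' 0 ord0 = 0 -> phi c = phi c' -> c = c'.
Proof.
move=> c0 c'0 /(congr1 vsval); rewrite !val_phi => /eqP.
rewrite -subr_eq0 -mulmxBl => /eqP cM; apply/eqP; rewrite -subr_eq0; apply/eqP.
apply: (form_posdef A_gcm A_indec a_delta d_gt0 d_sym).
  by rewrite !mxE c0 c'0 subr0.
rewrite formE exchange_big big1 //= => j _; rewrite -mulr_suml.
have -> : \sum_i (c - c') 0 i * gram A d i j = ((c - c') *m M) 0 j / d j.
  by rewrite mxE mulr_suml; apply: eq_bigr => i _; rewrite !mxE mulrA.
by rewrite cM mxE !mul0r.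
Qed.

Lemma deltaE i : delta R a i 0 = (a i)%:R.
Proof.
rewrite summxE (bigD1 i) //= big1 => [|j ji]; rewrite !mxE ?eqxx.
  by rewrite mulr1 addr0.
by rewrite eq_sym (negPf ji) mulr0.
Qed.

(** The row space of [M] lies in the kernel of [delta], and both have rank [n]. *)
Lemma phi_surj (x : H0) : exists c, x = phi c.
Proof.
have [rkM _ _] := A_affine.
suff /submxP [c cE] : (vsval x <= M)%MS.
  by exists c; apply: subvs_inj; rewrite val_phi -cE.
have delta0 : (delta R a)^T != 0.
  apply/eqP => /rowP /(_ ord0) /eqP; rewrite !mxE deltaE gt_eqF //.
  exact: a_gt0 a_delta _.
have sub : (M <= kermx (delta R a))%MS.
  apply/rV_subP => y /submxP [c ->]; apply/sub_kermxP.
  have := span_h0 c; rewrite mem_h0 /pairing => /eqP h.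
  by apply/matrixP => i j; rewrite !ord1 h mxE.
have [_ rkE] := mxrank_leqif_sup sub.
have ksub : (kermx (delta R a) <= M)%MS.
  by rewrite -rkE mxrank_ker rkM -[\rank (delta R a)]mxrank_tr rank_rV delta0 subSS subn0.
apply: submx_trans ksub.
apply/sub_kermxP; have := subvsP x; rewrite mem_h0 /pairing => /eqP h.
by apply/matrixP => i j; rewrite !ord1 h mxE.
Qed.

Lemma affine_refl i : affine_weyl A (refl R A i).
Proof. by exists [:: i] => //; rewrite big_cons big_nil comp_lfun1r. Qed.

Lemma refl_phi i c : s i (phi c) = phi (act1 i c).
Proof.
apply: subvs_inj; rewrite (val_cl a_delta _ (affine_refl i)) !val_phi reflE.
by rewrite /pairing /act1 mulmxBl -scalemxAl -rowE /root -colE mxE.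
Qed.

(** * Words in the reflections and the finite Weyl group *)

Definition word (l : seq 'I_n.+1) : 'End(H0) :=
  foldr (fun i w => (s i \o w)%VF) \1%VF l.

Lemma word_phi l c : word l (phi c) = phi (act l c).
Proof.
elim: l => /= [|i l IH]; first by rewrite id_lfunE.
by rewrite comp_lfunE IH refl_phi.
Qed.

Lemma eq_word l l' : act l =1 act l' -> word l = word l'.
Proof.
by move=> ll'; apply/lfunP => x; have [c ->] := phi_surj x; rewrite !word_phi ll'.
Qed.

Lemma word_cat l l' : word (l ++ l') = (word l \o word l')%VF.
Proof.
elim: l => /= [|i l ->]; first by rewrite comp_lfun1l.
by rewrite comp_lfunA.
Qed.

Lemma word_rev l : (word (rev l) \o word l)%VF = \1%VF.
Proof.
rewrite -word_cat -[RHS]/(word [::]); apply: eq_word => c.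
elim: l c => //= i l IH c; rewrite rev_cons cat_rcons act_cat /=.
by rewrite act1K // -act_cat IH.
Qed.

Lemma word_inv l : (word l)^-1%VF = word (rev l).
Proof.
have ker0 : lker (word l) == 0%VS.
  apply/lker0P => x y /(congr1 (word (rev l))).
  by rewrite -!comp_lfunE word_rev !id_lfunE.
rewrite -[LHS]comp_lfun1l -(word_rev l) -comp_lfunA lker0_compfV //.
by rewrite comp_lfun1r.
Qed.

Lemma cl_word l : cl a (\big[@comp_lfun R V V V / \1%VF]_(i <- l) refl R A i) = word l.
Proof.
elim: l => /= [|i l IH].
  by rewrite big_nil; apply/lfunP => x; rewrite !comp_lfunE !id_lfunE !lfunE /= vsvalK.
rewrite big_cons (cl_comp a_delta) ?IH //; first exact: affine_refl.
by exists l => //; exact: all_predT.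
Qed.

(** This is where the labelling enters: the letter 0 can be eliminated from any word. *)
Lemma finite_weyl_word w : finite_weyl A w ->
  exists2 l, all (predC1 ord0) l & w = word l.
Proof.
have [_ _ surj] := labelling; move=> /surj [v [l l0 ->] <-].
by exists l => //; rewrite cl_word.
Qed.

Lemma word_finite_weyl l : finite_weyl A (word l).
Proof.
rewrite -cl_word; eexists; last by [].
by exists l => //; exact: all_predT.
Qed.

Lemma coroot0E i : coroot0 R A a i = phi (e i).
Proof. by rewrite /coroot0 /phi -rowE. Qed.

(** Both coefficient rows vanish at [ord0], so [phi_inj] identifies the real coefficients witnessing
    positivity with those of the coroot. *)
Lemma positive_corootsE (b : H0) : positive_coroots A b <-> b \in map phi P.
Proof.
split=> [[[w [i [/finite_weyl_word [l l0 ->] i0 ->]]] [x [x0]]]|]; last first.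
  move=> /mapP [c /P_spec [cR c0] ->]; split.
    have [l [j [l0 j0 ->]]] := cR; exists (word l), j.
    by rewrite coroot0E word_phi; split=> //; exact: word_finite_weyl.
  exists (c 0); split=> //; under eq_bigr do rewrite coroot0E -phiZ.
  rewrite -phi_sum; congr phi; rewrite {1}[c]row_sum_delta (bigD1 ord0) //=.
  by rewrite (coroot_0 cR) scale0r add0r.
rewrite coroot0E word_phi; under eq_bigr do rewrite coroot0E -phiZ.
rewrite -phi_sum => /phi_inj cE; apply: map_f; apply/P_spec; split.
  by exists l, i.
move=> k; rewrite cE.
- rewrite summxE; apply: sumr_ge0 => j _.
  by rewrite !mxE mulr_ge0 // ler0n.
- by apply: act_0 => //; rewrite mxE [_ == i]eq_sym (negPf i0) andbF.
- rewrite summxE big1 // => j j0.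
  by rewrite !mxE [_ == j]eq_sym (negPf j0) andbF mulr0.
Qed.

Lemma rho_checkE : rho_check R A a = phi (rho P).
Proof.
have uphi : uniq (map phi P).
  rewrite map_inj_in_uniq // => c c' /P_spec [cR _] /P_spec [c'R _].
  exact: phi_inj (coroot_0 cR) (coroot_0 c'R).
rewrite /rho_check /rho phiZ phi_sum; congr (_ *: _).
have -> : @positive_coroots R n A a = [set` map phi P]%classic :> set H0.
  by apply/seteqP; split=> b /positive_corootsE.
by rewrite -fsbig_seq // big_map.
Qed.

Lemma rho_stabilizer l : all (predC1 ord0) l ->
  word l (rho_check R A a) = rho_check R A a -> word l = \1%VF.
Proof.
move=> l0; rewrite rho_checkE word_phi => /phi_inj fixes.
rewrite -[RHS]/(word [::]); apply: eq_word.
have [_] := act_rho_le A_gcm A_indec a_delta d_gt0 d_sym P_uniq P_spec l0.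
by apply; apply: fixes; [apply: act_0 => // |]; exact: rho0 P_spec.
Qed.

Lemma act_half_integral l (c : V) : (forall i, 2 * c 0 i \is a Num.int) ->
  forall i, 2 * act l c 0 i \is a Num.int.
Proof.
move=> cZ; elim: l => //= k l IH i.
rewrite /act1 mxE [X in _ + X]mxE mulrBr rpredB // !mxE mulrA rpredM ?rpred_nat //.
rewrite mulr_sumr rpred_sum // => m _.
by rewrite mxE mulrA rpredM // intr_int.
Qed.

(** The coefficients stay half-integral, and invariance of [form] fixes their norm, so
    [coordinates_bounded] confines them to a finite set. *)
Lemma finite_orbit : finite_set
  [set x | exists2 w, finite_weyl A w & x = w (rho_check R A a)]%classic.
Proof.
have [B hB] := coordinates_bounded A_gcm A_indec a_delta d_gt0 d_sym
  (form A d (rho P) (rho P)).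
apply: (@sub_finite_set _ _ (phi @` [set c : V |
    (forall i, 2 * c 0 i \is a Num.int) /\ forall i, `|c 0 i| <= B])%classic).
  move=> x [w /finite_weyl_word [l l0 ->] ->].
  rewrite rho_checkE word_phi; exists (act l (rho P)) => //; split.
    by apply: act_half_integral => i; exact: rho_half_integral P_spec i.
  apply: hB; first by apply: act_0 => //; exact: rho0 P_spec.
  by rewrite (form_act A_gcm d_gt0 d_sym).
exact/finite_image/finite_half_integral.
Qed.

(** * Heights and the vectors reached by the operators *)

Definition height (i : 'I_n.+1) (x : H0) : R := pairing (vsval x) (Defs.root R i).

Lemma val_refl i (x : H0) : vsval (s i x) = vsval x - height i x *: coroot R A i.
Proof. by rewrite (val_cl a_delta _ (affine_refl i)) reflE. Qed.

Lemma height_refl i x : height i (s i x) = - height i x.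
Proof.
have hE y : height i y = vsval y 0 i by rewrite /height /pairing /Defs.root -colE mxE.
by rewrite hE val_refl !mxE gcm_diag // hE; ring.
Qed.

Lemma reflK i : involutive (s i).
Proof.
move=> x; apply: subvs_inj; rewrite val_refl height_refl val_refl scaleNr.
by rewrite opprK subrK.
Qed.

Lemma sum_height (x : H0) : \sum_i (a i)%:R * height i x = 0.
Proof.
have := subvsP x; rewrite mem_h0 /pairing => /eqP; apply: etrans.
rewrite /delta mulmx_sumr summxE; apply: eq_bigr => i _.
by rewrite -scalemxAr [RHS]mxE.
Qed.

Lemma inv_rcons l i x :
  (word (rcons l i))^-1%VF x = s i ((word l)^-1%VF x).
Proof. by rewrite !word_inv rev_rcons /= comp_lfunE. Qed.

Lemma pi_act_word l i : pi_act A (word l) i =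
  if 0 < height i ((word l)^-1%VF (rho_check R A a)) then word (rcons l i) else word l.
Proof. by rewrite /pi_act -cats1 word_cat /= comp_lfun1r. Qed.

Lemma foldl_pi_act_word l m :
  exists l', foldl (@pi_act R n A a) (word l) m = word l'.
Proof.
elim: m l => [|i m IH] l /=; first by exists l.
by rewrite pi_act_word; case: ifP.
Qed.

Lemma reachable_orbit l m : exists ms,
  ((foldl (@pi_act R n A a) (word l) ms)^-1)%VF (rho_check R A a) =
  word m ((word l)^-1%VF (rho_check R A a)).
Proof.
pose Y := [set x | exists ms,
  x = ((foldl (@pi_act R n A a) (word l) ms)^-1)%VF (rho_check R A a)]%classic.
suff : Y (word m ((word l)^-1%VF (rho_check R A a))) by move=> [ms ->]; exists ms.
have Y_fin : finite_set Y.
  apply: sub_finite_set finite_orbit => x [ms ->].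
  have [l' ->] := foldl_pi_act_word l ms; rewrite word_inv.
  by exists (word (rev l')) => //; exact: word_finite_weyl.
have Y_step i x : Y x -> 0 < height i x -> Y (s i x).
  move=> [ms ->] pos; exists (rcons ms i); rewrite foldl_rcons.
  have [l' ll'] := foldl_pi_act_word l ms; move: pos; rewrite ll' => pos.
  by rewrite pi_act_word pos inv_rcons.
have Y_refl := circulation_closed Y_fin reflK height_refl
  (a_gt0 R a_delta) sum_height Y_step.
elim: m => [|i m IH] /=; first by exists [::]; rewrite id_lfunE.
rewrite comp_lfunE; set x := word m _ in IH *.
(* At height 0 the reflection fixes [x]; otherwise the circulation argument applies whatever the
   sign. *)
have [h0|] := eqVneq (height i x) 0; last exact: Y_refl.
suff -> : s i x = x by [].
by apply: subvs_inj; rewrite val_refl h0 scale0r subr0.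
Qed.

Lemma level_zero_transitive (u v : 'End(H0)) : finite_weyl A u -> finite_weyl A v ->
  exists l, foldl (@pi_act R n A a) u l = v.
Proof.
move=> /finite_weyl_word [lu _ ->] /finite_weyl_word [lv _ ->].
(* This word carries the vector of [u], its inverse applied to [rho_check], to the vector of [v]. *)
have [ms msE] := reachable_orbit lu (rev lv ++ lu); exists ms.
have [l' l'E] := foldl_pi_act_word lu ms; rewrite l'E in msE *.
move: msE; rewrite word_cat comp_lfunE !word_inv.
rewrite -[X in word (rev lv) X]comp_lfunE -{1}[lu]revK word_rev id_lfunE => E.
(* The product [lv ++ rev l'] fixes [rho_check] but may contain the letter 0, so it is rewritten
   before [rho_stabilizer] applies. *)
have [w w0 wE] := finite_weyl_word (word_finite_weyl (lv ++ rev l')).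
have w1 : word w = \1%VF.
  apply: rho_stabilizer => //; rewrite -wE word_cat comp_lfunE E -comp_lfunE.
  by rewrite -{1}[lv]revK word_rev id_lfunE.
rewrite -[RHS]comp_lfun1r -(word_rev l') comp_lfunA -word_cat wE w1.
by rewrite comp_lfun1l.
Qed.

End LevelZeroOrbit.

Theorem theorem4p2 (R : realType) (n : nat) (A : 'M[int]_n.+1)
    (a : 'I_n.+1 -> nat)
    (n_ge1 : (1 <= n)%N)
    (A_gcm : generalized_cartan A)
    (A_indec : indecomposable A)
    (A_affine : affine_type R A)
    (a_delta : delta_coefficients A a)
    (labelling : good_labelling R A a)
    (u v : 'End(subvs_of (h0 R a))) :
  finite_weyl A u -> finite_weyl A v ->
  exists l : seq 'I_n.+1, foldl (pi_act A (a := a)) u l = v.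
Proof.
have [d [d_gt0 d_sym]] := symmetrizable R A_gcm A_indec a_delta.
have [P [P_uniq P_spec]] :=
  positive_coroot_seq A_gcm A_indec a_delta d_gt0 d_sym.
exact: (level_zero_transitive A_gcm A_indec A_affine a_delta labelling
  d_gt0 d_sym P_uniq P_spec).
Qed.
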